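(* Let $D$ be an integral domain and let $I$ be a proper $t$-invertible valuation $t$-ideal of $D$ (that is, $I$ is a proper ideal which is a $t$-ideal, is $t$-invertible, and is a valuation ideal). Then there exists a unique maximal $t$-ideal $M$ of $D$ such that $I\subseteq M$.
   Context: Let $D$ be an integral domain with quotient field $K$. For a nonzero fractional ideal $A$ of $D$, $A^{-1}=\{x\in K\mid xA\subseteq D\}$, $A_v=(A^{-1})^{-1}$, and $A_t=\bigcup\{J_v\mid J\subseteq A,\ J$ a nonzero finitely generated fractional ideal of $D\}$. A $t$-ideal is a nonzero ideal $I\subseteq D$ with $I_t=I$; a maximal $t$-ideal is a $t$-ideal maximal among the proper $t$-ideals. $I$ is $t$-invertible if $(II^{-1})_t=D$. An overring of $D$ is a subring of $K$ containing $D$. An ideal $I$ of $D$ is a valuation ideal if there is a valuation overring $V$ of $D$ with $IV\cap D=I$. *)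

(* Defs.v *)
From mathcomp Require Import all_boot all_order all_algebra.
From mathcomp Require Import boolp classical_sets.

Set Implicit Arguments.
Unset Strict Implicit.
Unset Printing Implicit Defensive.

Import GRing.Theory.

Local Open Scope classical_set_scope.
Local Open Scope ring_scope.

(* All ideals, fractional ideals and overrings of D are subsets of the
   quotient field {fraction D}, in which D is identified with its image
   dom D under the canonical embedding tofrac. *)

Section Ideals.
Variable D : idomainType.

Notation K := {fraction D}.

Definition dom : set K := range (@tofrac D).

Definition submodule (A : set K) : Prop :=
  [/\ A 0, (forall x y, A x -> A y -> A (x + y))
    & (forall (d : D) x, A x -> A (tofrac d * x))].

Definition fractional_ideal (A : set K) : Prop :=
  submodule A /\
  exists2 d : D, d != 0 & forall x, A x -> dom (tofrac d * x).

Definition nonzero (A : set K) : Prop := exists2 x, A x & x != 0.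

Definition ideal (I : set K) : Prop := submodule I /\ I `<=` dom.

Definition finitely_generated (A : set K) : Prop :=
  exists (n : nat) (g : 'I_n -> K),
    A = [set x | exists c : 'I_n -> D, x = \sum_(i < n) tofrac (c i) * g i].

(* Finite sums of products, not just the pointwise products. *)
Definition idmul (A B : set K) : set K :=
  [set x | exists (n : nat) (a b : 'I_n -> K),
     (forall i, A (a i) /\ B (b i)) /\ x = \sum_(i < n) a i * b i].

Definition idinv (A : set K) : set K := [set x | forall a, A a -> dom (x * a)].

Definition vcl (A : set K) : set K := idinv (idinv A).

Definition tcl (A : set K) : set K :=
  [set x | exists J : set K,
     [/\ fractional_ideal J, finitely_generated J, nonzero J, J `<=` A
       & vcl J x]].

Definition t_ideal (I : set K) : Prop :=
  [/\ ideal I, nonzero I & tcl I = I].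

Definition neq_dom (I : set K) : Prop := I <> dom.

Definition maximal_t_ideal (M : set K) : Prop :=
  [/\ t_ideal M, neq_dom M
    & forall J, t_ideal J -> neq_dom J -> M `<=` J -> J = M].

Definition t_invertible (I : set K) : Prop := tcl (idmul I (idinv I)) = dom.

Definition overring (V : set K) : Prop :=
  subring_closed (mem V) /\ dom `<=` V.

(* An overring of D has quotient field K, so it is a valuation domain exactly
   when it contains x or x^-1 for every nonzero x in K. *)
Definition valuation_overring (V : set K) : Prop :=
  overring V /\ forall x : K, x != 0 -> V x \/ V x^-1.

Definition valuation_ideal (I : set K) : Prop :=
  ideal I /\
  exists2 V : set K, valuation_overring V & idmul I V `&` dom = I.

End Ideals.

(* Main.v *)
Require Import Defs.
From mathcomp Require Import all_boot all_order all_algebra.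
From mathcomp Require Import boolp classical_sets.

(** Write A^-1 for [idinv A].  Finite subsets suffice to compute the t-closure:
    x is in A_t exactly when some finite s in A satisfies x s^-1 <= D ([tclP]).
    Existence of a maximal t-ideal above I is then Zorn's lemma, because a
    union of a chain of t-ideals is a t-ideal ([t_ideal_bigcup]).

    For uniqueness it is enough to show that two proper t-ideals M, N that
    contain I have (M + N)_t different from D ([proper_tcl_sum]): this t-ideal
    contains both, so it equals both when they are maximal.  Let V be the
    valuation overring with IV :&: D = I.  Since I is t-invertible, there is a
    finite set in I with the same inverse as I ([t_invertible_finite]), and
    (I : I) = D ([t_invertible_colon]).  Let p be finite in M and q finite in N,
    both enlarged by that finite set.  As M and N are proper t-ideals, there are
    x in p^-1 and y in q^-1, neither of them in D.  By symmetry suppose that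
    x / y is in V.  For n in q, the element x n = (x / y) (y n) is in V, so that
    (x n) I <= IV; on the other hand (x n) I <= D since x I <= D.  Hence
    (x n) I <= I and x n is in D ([seqinv_transfer]).  So x, which is not in D,
    multiplies both p and q into D, and no finite subset of M + N can witness
    1 in (M + N)_t. *)

Set Implicit Arguments.
Unset Strict Implicit.
Unset Printing Implicit Defensive.

Import GRing.Theory.

Local Open Scope classical_set_scope.
Local Open Scope ring_scope.

Section TIdeals.
Variable D : idomainType.

Notation K := {fraction D}.
Implicit Types (A B I M N V : set K) (s : seq K) (x y : K).

(** * Finite sets of generators and the t-closure *)

Lemma dom1 : @dom D 1.
Proof. by exists 1 => //; rewrite rmorph1. Qed.

Lemma domD x y : dom x -> dom y -> dom (x + y).
Proof. by move=> [a _ <-] [b _ <-]; exists (a + b) => //; rewrite rmorphD. Qed.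

Lemma domM x y : dom x -> dom y -> dom (x * y).
Proof. by move=> [a _ <-] [b _ <-]; exists (a * b) => //; rewrite rmorphM. Qed.

Lemma submodule_sum A n (f : 'I_n -> K) :
  submodule A -> (forall i, A (f i)) -> A (\sum_(i < n) f i).
Proof. by move=> [A0 AD _] Af; apply: (big_ind A). Qed.

Lemma submodule_dom : submodule (@dom D).
Proof.
split; first by exists 0 => //; rewrite rmorph0.
  exact: domD.
by move=> d x; apply: domM; exists d.
Qed.

Lemma dom_sum n (f : 'I_n -> K) :
  (forall i, dom (f i)) -> dom (\sum_(i < n) f i).
Proof. exact: submodule_sum submodule_dom. Qed.

Lemma proper_ideal1 A : ideal A -> neq_dom A -> ~ A 1.
Proof.
move=> [[_ _ AM] AD] Aneq A1; apply: Aneq; apply/seteqP; split=> // x [d _ <-].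
by rewrite -[tofrac d]mulr1; apply: AM.
Qed.

(** The inverse of the fractional ideal generated by the entries of s.  All
    v-closures of finitely generated ideals are handled through it, since
    x lies in the v-closure of such an ideal exactly when x multiplies this
    inverse into D. *)
Definition seqinv s : set K := [set y | {in s, forall a, dom (y * a)}].

Lemma seqinv_cat s1 s2 : seqinv (s1 ++ s2) = seqinv s1 `&` seqinv s2.
Proof.
apply/seteqP; split=> [y ys | y [ys1 ys2] a].
  by split=> a sa; apply: ys; rewrite mem_cat sa ?orbT.
by rewrite mem_cat => /orP[/ys1|/ys2].
Qed.

Definition span s : set K :=
  [set x | exists c : 'I_(size s) -> D, x = \sum_(i < size s) tofrac (c i) * s`_i].

Lemma submodule_span s : submodule (span s).
Proof.
split.
- by exists (fun=> 0); rewrite big1 // => i _; rewrite rmorph0 mul0r.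
- move=> _ _ [c ->] [e ->]; exists (fun i => c i + e i).
  by rewrite -big_split; apply: eq_bigr => i _; rewrite rmorphD mulrDl.
- move=> d _ [c ->]; exists (fun i => d * c i).
  by rewrite mulr_sumr; apply: eq_bigr => i _; rewrite rmorphM mulrA.
Qed.

Lemma mem_span s x : x \in s -> span s x.
Proof.
move=> xs; have lt_s : (index x s < size s)%N by rewrite index_mem.
exists (fun i => (i == Ordinal lt_s)%:R).
rewrite (bigD1 (Ordinal lt_s)) //= eqxx rmorph1 mul1r nth_index //.
by rewrite big1 ?addr0 // => i /negPf->; rewrite rmorph0 mul0r.
Qed.

Lemma span_sub A s : submodule A -> {in s, forall a, A a} -> span s `<=` A.
Proof.
move=> sA As x [c ->]; apply: submodule_sum => // i.
by case: sA => _ _ AM; apply/AM/As/mem_nth.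
Qed.

(** A pointwise supply of finite subsets of A merges into a single one, because
    seqinv turns concatenation into intersection. *)
Lemma seqinv_merge A (T : eqType) (r : seq T) (P : T -> set K) :
  {in r, forall t, exists2 s, {in s, forall a, A a} & seqinv s `<=` P t} ->
  exists2 s, {in s, forall a, A a} & {in r, forall t, seqinv s `<=` P t}.
Proof.
elim: r => [_|t r IHr Hr]; first by exists [::].
have [|s As sP] := IHr; first by move=> u ru; apply: Hr; rewrite inE ru orbT.
have [q Aq qP] := Hr t (mem_head t r).
exists (q ++ s) => [a|u ru y]; first by rewrite mem_cat => /orP[/Aq|/As].
rewrite seqinv_cat => -[qy sy]; move: ru.
by rewrite inE => /predU1P[->|/sP]; [apply: qP | apply].
Qed.

Lemma tcl_seqinv A x : tcl A x ->
  exists2 s, {in s, forall a, A a} & forall y, seqinv s y -> dom (x * y).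
Proof.
move=> [J [_ [n [g ->]] _ gA Jx]]; exists (codom g) => [a /codomP[i ->]|y yg].
  apply: gA; exists (fun j => (j == i)%:R).
  rewrite (bigD1 i) //= eqxx rmorph1 mul1r big1 ?addr0 // => j /negPf->.
  by rewrite rmorph0 mul0r.
apply: Jx => _ [c ->]; rewrite mulr_sumr; apply: dom_sum => i.
by rewrite mulrCA; apply: domM; [exists (c i) | apply/yg/codom_f].
Qed.

Lemma tclP A x : ideal A -> nonzero A ->
  tcl A x <-> exists2 s, {in s, forall a, A a}
                & forall y, seqinv s y -> dom (x * y).
Proof.
move=> [sA AD] [a0 Aa0 a0n0]; split=> [/tcl_seqinv // | [s As xs]].
(* The ideal J of the definition must be nonzero, hence the generator a0. *)
have As' : {in a0 :: s, forall a, A a}.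
  by move=> a; rewrite inE => /predU1P[->|/As].
exists (span (a0 :: s)); split.
- split; first exact: submodule_span.
  exists 1 => [|z /(span_sub sA As') /AD]; first exact: oner_neq0.
  by rewrite rmorph1 mul1r.
- by exists (size (a0 :: s)), (fun i => (a0 :: s)`_i).
- by exists a0 => //; apply: mem_span; rewrite mem_head.
- exact: span_sub.
- move=> y ys; apply: xs => a sa; apply/ys/mem_span.
  by rewrite inE sa orbT.
Qed.

Lemma sub_tcl A : ideal A -> nonzero A -> A `<=` tcl A.
Proof.
move=> iA nA x Ax; apply/(tclP _ iA nA).
exists [:: x] => [a|y]; first by rewrite inE => /eqP->.
by rewrite mulrC; apply; rewrite inE.
Qed.

Lemma ideal_tcl A : ideal A -> nonzero A -> ideal (tcl A).
Proof.
move=> iA nA; have [sA AD] := iA; split; last first.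
  move=> x /(tclP _ iA nA)[s As /(_ 1)]; rewrite mulr1; apply=> a /As /AD.
  by rewrite mul1r.
split.
- by apply: sub_tcl => //; case: sA.
- move=> x y /(tclP _ iA nA)[s As xs] /(tclP _ iA nA)[r Ar yr].
  apply/(tclP _ iA nA); exists (s ++ r) => [a|z].
    by rewrite mem_cat => /orP[/As|/Ar].
  rewrite seqinv_cat => -[/xs xz /yr yz].
  by rewrite mulrDl; apply: domD.
- move=> d x /(tclP _ iA nA)[s As xs].
  apply/(tclP _ iA nA); exists s => // z /xs xz.
  by rewrite -mulrA; apply: domM => //; exists d.
Qed.

Lemma nonzero_sub A B : A `<=` B -> nonzero A -> nonzero B.
Proof. by move=> AB [x /AB Bx x0]; exists x. Qed.

(** Each element of a finite set in A_t has its own finite witness in A, and the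
    merged witnesses control the whole set. *)
Lemma tcl_idem A : ideal A -> nonzero A -> tcl (tcl A) `<=` tcl A.
Proof.
move=> iA nA x /tcl_seqinv[s Ts xs].
have [|r Ar rs] := @seqinv_merge A K s (fun b => [set y | dom (y * b)]).
  move=> b /Ts /tcl_seqinv[q Aq bq].
  by exists q => // y /bq; rewrite mulrC.
by apply/(tclP _ iA nA); exists r => // y ry; apply: xs => b /rs; apply.
Qed.

Lemma t_ideal_sub A : ideal A -> nonzero A -> tcl A `<=` A -> t_ideal A.
Proof.
move=> iA nA tA; split=> //; apply/seteqP; split=> //; exact: sub_tcl.
Qed.

Lemma t_ideal_tcl A : ideal A -> nonzero A -> t_ideal (tcl A).
Proof.
move=> iA nA; apply: t_ideal_sub (tcl_idem iA nA); first exact: ideal_tcl.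
exact: nonzero_sub (sub_tcl iA nA) nA.
Qed.

Lemma proper_t_ideal_seqinv M s : t_ideal M -> neq_dom M ->
  {in s, forall a, M a} -> exists2 x, seqinv s x & ~ dom x.
Proof.
move=> [iM nM tM] Mneq Ms; apply/existsPNP => sD.
apply: (proper_ideal1 iM Mneq); rewrite -tM; apply/(tclP _ iM nM).
by exists s => // y /sD; rewrite mul1r.
Qed.

(** * Unions of chains of t-ideals *)

Lemma chain_seq (F : set (set K)) s : F !=set0 -> total_on F subset ->
  {in s, forall a, (\bigcup_(X in F) X) a} ->
  exists2 X, F X & {in s, forall a, X a}.
Proof.
move=> [X0 FX0] totF; elim: s => [_|b s IHs Us]; first by exists X0.
have [|X FX Xs] := IHs; first by move=> a sa; apply: Us; rewrite inE sa orbT.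
have [Y FY Yb] := Us b (mem_head b s).
have [XY|YX] := totF X Y FX FY.
  by exists Y => // a; rewrite inE => /predU1P[->|/Xs/XY].
by exists X => // a; rewrite inE => /predU1P[->|/Xs//]; apply: YX.
Qed.

(** Both closure under addition and t-closedness involve only finitely many
    elements of the union at a time, and these lie in one member of the chain. *)
Lemma t_ideal_bigcup (F : set (set K)) : F !=set0 -> total_on F subset ->
  (forall X, F X -> t_ideal X) -> t_ideal (\bigcup_(X in F) X).
Proof.
move=> F0 totF tF; have [X0 FX0] := F0.
have [[[X00 _ _] _] [z X0z z0] _] := tF _ FX0.
have iU : ideal (\bigcup_(X in F) X).
  split; last by move=> x [X /tF[[_ XD] _ _] /XD].
  split; first by exists X0.
  - move=> x y Ux Uy; have [|X FX Xs] := @chain_seq F [:: x; y] F0 totF.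
      by move=> a; rewrite !inE => /orP[]/eqP->.
    have [[[_ XD _] _] _ _] := tF _ FX.
    by exists X => //; apply: XD; apply: Xs; rewrite !inE eqxx ?orbT.
  - move=> d x [X FX Xx]; have [[[_ _ XM] _] _ _] := tF _ FX.
    by exists X => //; apply: XM.
apply: t_ideal_sub => //; first by exists z => //; exists X0.
move=> x /tcl_seqinv[s Us xs]; have [X FX Xs] := chain_seq F0 totF Us.
have [iX nX tX] := tF _ FX.
by exists X => //; rewrite -tX; apply/(tclP _ iX nX); exists s.
Qed.

Lemma exists_maximal_t_ideal I : t_ideal I -> neq_dom I ->
  exists2 M, maximal_t_ideal M & I `<=` M.
Proof.
move=> tI Ineq.
(* Adjoining I to each member lets the empty chain have the upper bound I. *)
pose P := [set A | t_ideal (A `|` I) /\ neq_dom (A `|` I)].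
have [F FP totF|A [[tA Aneq] Amax]] := @Zorn_bigcup K P.
  pose G := [set I] `|` [set X `|` I | X in F].
  have GE : (\bigcup_(X in F) X) `|` I = \bigcup_(X in G) X.
    apply/seteqP; split=> x.
      move=> [[X FX Xx]|Ix]; last by exists I => //; left.
      by exists (X `|` I); [right; exists X | left].
    move=> [_ [->|[X FX <-]]]; first by move=> Ix; right.
    by move=> [Xx|Ix]; [left; exists X | right].
  have tG X : G X -> t_ideal X /\ neq_dom X.
    by move=> [->//|[Y /FP[tY Yneq] <-]].
  rewrite /P /= GE; split.
    apply: t_ideal_bigcup; [by exists I; left | | by move=> X /tG[]].
    move=> _ _ [->|[X FX <-]] [->|[Y FY <-]]; first by left.
    - by left=> x; right.
    - by right=> x; right.
    - by have [XY|YX] := totF X Y FX FY; [left|right]; apply: setSU.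
  move=> GD; have [X GX X1] : (\bigcup_(X in G) X) 1 by rewrite GD; apply: dom1.
  have [[iX _ _] Xneq] := tG _ GX.
  exact: proper_ideal1 X1.
exists (A `|` I); last by right.
split=> // J tJ Jneq AJ; have IJ : J `|` I = J.
  by apply/setUidPl => x Ix; apply: AJ; right.
apply: contrapT => JA; apply: (Amax J); last by rewrite /P /= IJ.
split=> [x Ax|JA']; first by apply: AJ; left.
by apply: JA; apply/seteqP; split=> // x /JA'; left.
Qed.

(** * t-invertible ideals *)

(** If x I <= I then x I I^-1 <= I I^-1 <= D, so x lies in (I I^-1)^-1, which
    is D because 1 is in the t-closure of I I^-1. *)
Lemma t_invertible_colon I x : t_invertible I ->
  (forall c, I c -> I (x * c)) -> dom x.
Proof.
move=> Iinv xI.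
have [F FI F1] : exists2 s, {in s, forall f, idmul I (idinv I) f}
    & forall y, seqinv s y -> dom (1 * y).
  by apply: tcl_seqinv; rewrite Iinv; apply: dom1.
rewrite -[x]mul1r; apply: F1 => f /FI[n [a [b [ab ->]]]].
rewrite mulr_sumr; apply: dom_sum => i; have [Ia Ib] := ab i.
by rewrite mulrA mulrC; apply/Ib/xI.
Qed.

(** That 1 is in the t-closure of I I^-1 is witnessed by finitely many sums f
    of products a_i b_i, and the factors a_i form the required set: if x
    multiplies all of them into D and c is in I, then x c f is the sum of the
    (x a_i) (c b_i), which are in D, whence x c is in D. *)
Lemma t_invertible_finite I : t_invertible I ->
  exists2 s, {in s, forall a, I a} & seqinv s `<=` idinv I.
Proof.
move=> Iinv.
have [F FI F1] : exists2 s, {in s, forall f, idmul I (idinv I) f}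
    & forall y, seqinv s y -> dom (1 * y).
  by apply: tcl_seqinv; rewrite Iinv; apply: dom1.
have [|s Is sF] :=
    @seqinv_merge I K F (fun f => [set x | forall c, I c -> dom (x * c * f)]).
  move=> f /FI[n [a [b [ab ->]]]].
  exists (codom a) => [z /codomP[i ->]|x xa c Ic]; first by have [] := ab i.
  rewrite mulr_sumr; apply: dom_sum => i; have [_ Ib] := ab i.
  rewrite mulrACA; apply: domM; first exact/xa/codom_f.
  by rewrite mulrC; apply: Ib.
exists s => // x xs c Ic; rewrite -[x * c]mul1r.
by apply: F1 => f /sF; apply.
Qed.

(** * Proper t-ideals above a t-invertible valuation ideal *)

(** The valuation compares the fractional elements x and y, and the contraction
    property of I carries the comparison back to D. *)
Lemma seqinv_transfer I V q x y : t_invertible I -> overring V ->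
  idmul I V `&` @dom D = I -> idinv I x -> y != 0 -> V (x / y) ->
  {in q, forall n, dom n} -> seqinv q y -> seqinv q x.
Proof.
move=> Iinv [[_ _ VM] DV] IV Ix y0 Vxy qD qy n qn.
have Vxn : V (x * n).
  rewrite -(divfK y0 x) -(mulrA (x / y)); apply/set_mem/VM; apply/mem_set => //.
  by apply: DV; exact: qy.
apply: (t_invertible_colon Iinv) => c Ic; rewrite -IV; split.
  exists 1, (fun=> c), (fun=> x * n); split=> [//|].
  by rewrite big_ord1 mulrC.
by rewrite mulrAC; apply: domM; [apply: Ix | apply: qD].
Qed.

Definition idsum A B : set K := [set x | exists2 a, A a & exists2 b, B b & x = a + b].

Lemma ideal_idsum A B : ideal A -> ideal B -> ideal (idsum A B).
Proof.
move=> [[A0 AD AM] Adom] [[B0 BD BM] Bdom]; split; last first.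
  by move=> _ [a /Adom Aa [b /Bdom Bb ->]]; apply: domD.
split.
- by exists 0 => //; exists 0 => //; rewrite addr0.
- move=> _ _ [a Aa [b Bb ->]] [c Ac [d Bd ->]].
  by exists (a + c); [exact: AD | exists (b + d); [exact: BD | rewrite addrACA]].
- move=> d _ [a Aa [b Bb ->]]; exists (tofrac d * a); first exact: AM.
  by exists (tofrac d * b); [exact: BM | rewrite mulrDr].
Qed.

Lemma idsum_seqinv A B s : {in s, forall a, idsum A B a} ->
  exists p q, [/\ {in p, forall a, A a}, {in q, forall b, B b}
    & seqinv p `&` seqinv q `<=` seqinv s].
Proof.
elim: s => [_|c s IHs Ss]; first by exists [::], [::].
have [|p [q [Ap Bq pq]]] := IHs.
  by move=> a sa; apply: Ss; rewrite inE sa orbT.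
have [a Aa [b Bb Ec]] := Ss c (mem_head c s).
exists (a :: p), (b :: q); split.
- by move=> z; rewrite inE => /predU1P[->|/Ap].
- by move=> z; rewrite inE => /predU1P[->|/Bq].
- move=> x [xp xq] z; rewrite inE => /predU1P[->|].
    by rewrite Ec mulrDr; apply: domD; [apply: xp | apply: xq]; rewrite mem_head.
  by apply: pq; split=> w Hw; [apply: xp | apply: xq]; rewrite inE Hw orbT.
Qed.

(** The elements x and y witness that M and N are proper; the valuation makes
    one of them witness that M + N has a proper t-closure as well. *)
Lemma proper_tcl_sum I M N : t_invertible I -> valuation_ideal I ->
  t_ideal M -> neq_dom M -> I `<=` M -> t_ideal N -> neq_dom N -> I `<=` N ->
  neq_dom (tcl (idsum M N)).
Proof.
move=> Iinv [_ [V [oV valV] IV]] tM Mneq IM tN Nneq IN sumD.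
have [s sS s1] : exists2 s, {in s, forall a, idsum M N a}
    & forall z, seqinv s z -> dom (1 * z).
  by apply: tcl_seqinv; rewrite sumD; apply: dom1.
have [p [q [Mp Nq pqs]]] := idsum_seqinv sS.
have [r Ir rI] := t_invertible_finite Iinv.
have Mpr : {in p ++ r, forall a, M a}.
  by move=> a; rewrite mem_cat => /orP[/Mp|/Ir/IM].
have Nqr : {in q ++ r, forall a, N a}.
  by move=> a; rewrite mem_cat => /orP[/Nq|/Ir/IN].
have [x + xD] := proper_t_ideal_seqinv tM Mneq Mpr.
rewrite seqinv_cat => -[px /rI Ix].
have [y + yD] := proper_t_ideal_seqinv tN Nneq Nqr.
rewrite seqinv_cat => -[qy /rI Iy].
have D0 : @dom D 0 by case: submodule_dom.
have x0 : x != 0 by apply: contra_not_neq xD => ->.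
have y0 : y != 0 by apply: contra_not_neq yD => ->.
have pD : {in p, forall m, dom m} by move=> m /Mp; case: tM => -[_ MD] _ _ /MD.
have qD : {in q, forall n, dom n} by move=> n /Nq; case: tN => -[_ ND] _ _ /ND.
have [|Vxy|] := valV (x / y); first by rewrite mulf_neq0 ?invr_eq0.
- apply: xD; rewrite -[x]mul1r; apply/s1/pqs; split=> //.
  exact: (seqinv_transfer Iinv oV IV Ix y0 Vxy qD qy).
- rewrite invf_div => Vyx; apply: yD; rewrite -[y]mul1r; apply/s1/pqs; split=> //.
  exact: (seqinv_transfer Iinv oV IV Iy x0 Vyx pD px).
Qed.

Lemma maximal_t_ideal_unique I M N : t_invertible I -> valuation_ideal I ->
  maximal_t_ideal M -> I `<=` M -> maximal_t_ideal N -> I `<=` N -> M = N.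
Proof.
move=> Iinv Ival [tM Mneq Mmax] IM [tN Nneq Nmax] IN.
have [[iM nM _] [iN _ _]] := (tM, tN).
have [[[M0 _ _] _] [[N0 _ _] _]] := (iM, iN).
have MS : M `<=` idsum M N by move=> x Mx; exists x => //; exists 0; rewrite ?addr0.
have NS : N `<=` idsum M N by move=> x Nx; exists 0 => //; exists x; rewrite ?add0r.
have iS := ideal_idsum iM iN; have nS := nonzero_sub MS nM.
have tS := t_ideal_tcl iS nS; have St := sub_tcl iS nS.
have Sneq := proper_tcl_sum Iinv Ival tM Mneq IM tN Nneq IN.
rewrite -(Mmax _ tS Sneq (subset_trans MS St)).
exact: Nmax _ tS Sneq (subset_trans NS St).
Qed.

End TIdeals.

Theorem corollary2p4 (D : idomainType) (I : set {fraction D})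
    (Iproper : neq_dom I) (It : t_ideal I) (Iinv : t_invertible I)
    (Ival : valuation_ideal I) :
  exists! M : set {fraction D}, maximal_t_ideal M /\ I `<=` M.
Proof.
have [M maxM IM] := exists_maximal_t_ideal It Iproper.
by exists M; split=> // N [maxN IN]; apply: maximal_t_ideal_unique maxM IM maxN IN.
Qed.
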